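(* Let $\mathscr{A}=(G,\partial)$ be a unicyclization of a connected graph $G$, let $\beta$ be a fixed basis of $Z_1(G)=\ker\partial_1$, let $w_{\mathscr{A}}(z)=\det([z]_\beta,[\partial]_\beta)$ be the winding number map relative to $\beta$, and let $$\lambda_{\mathscr{A}}=\sum_{Y\in\mathcal{U}(G)}w_{\mathscr{A}}(z_Y)\cdot z_Y .$$ Then for every $C\in\ker\partial_1$, $$C\circ\lambda_{\mathscr{A}}=w_{\mathscr{A}}(C)\cdot k(G),$$ where $k(G)$ is the number of spanning trees of $G$.
   Context: Graphs are finite and connected; loops and multiple edges are allowed. Fix an orientation of each edge. $C_1(G)=\mathbb{Z}^{E(G)}$, $C_0(G)=\mathbb{Z}^{V(G)}$, and $\partial_1:C_1(G)\to C_0(G)$ is the (oriented) incidence matrix (a loop gives a zero column). $Z_1(G)=\ker\partial_1$ is a free abelian group of rank $m=|E(G)|-|V(G)|+1$. The symbol $\circ$ is the standard inner product on $C_1(G)$ for which the edges are orthonormal. A unicyclizer of $G$ is an integer matrix $\partial$ (rows indexed by $E(G)$) with (1) $\ker\partial=0$, (2) $\partial_1\partial=0$, (3) $\operatorname{rk}(\ker\partial_1/\operatorname{im}\partial)=1$. So $\partial$ has $m-1$ linearly independent columns, all in $Z_1(G)$ (when $m=1$ it has no columns). The pair $\mathscr{A}=(G,\partial)$ is called a unicyclization of $G$. For a basis $\beta$ of $Z_1(G)$, $[z]_\beta\in\mathbb{Z}^m$ is the coordinate column vector of $z\in Z_1(G)$, $[\partial]_\beta$ is the $m\times(m-1)$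 matrix whose columns are the coordinate vectors of the columns of $\partial$, and $([z]_\beta,[\partial]_\beta)$ is the $m\times m$ matrix with first column $[z]_\beta$. A cycletree of $G$ is a connected spanning subgraph $Y$ of $G$ containing exactly one cycle $C_Y$ (a loop, or a pair of parallel edges, may be that cycle). $\mathcal{U}(G)$ is the set of cycletrees of $G$. $z_Y\in Z_1(G)$ is the $\{0,\pm1\}$-vector of $C_Y$ with either orientation chosen; the product $w_{\mathscr{A}}(z_Y)\cdot z_Y$ does not depend on this choice. *)

(* Defs.v *)
From HB Require Import structures.
From mathcomp Require Import all_boot all_order all_algebra.
From mathcomp Require classical_sets.

Set Implicit Arguments.
Unset Strict Implicit.
Unset Printing Implicit Defensive.

Import Order.TTheory GRing.Theory Num.Theory.
Local Open Scope ring_scope.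

Section IntegerLattices.

Definition mxker p q (M : 'M[int]_(p, q)) : 'cV[int]_q -> Prop :=
  fun z => M *m z = 0.

Definition mxim p q (M : 'M[int]_(p, q)) : 'cV[int]_p -> Prop :=
  fun z => exists x : 'cV[int]_q, z = M *m x.

Definition indep_mod p r (I : 'cV[int]_p -> Prop) (F : 'M[int]_(p, r)) : Prop :=
  forall x : 'cV[int]_r, I (F *m x) -> x = 0.

(* The abelian group K / I has rank r, the rank being the largest size of a
   family of elements of K (the columns of F) that is Z-linearly independent
   modulo I. *)
Definition quot_rank p (K I : 'cV[int]_p -> Prop) (r : nat) : Prop :=
  (exists F : 'M[int]_(p, r), (forall j, K (col j F)) /\ indep_mod I F) /\
  (forall s (F : 'M[int]_(p, s)),
     (forall j, K (col j F)) -> indep_mod I F -> (s <= r)%N).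

(* A basis is given by the matrix whose columns are the basis vectors. *)
Definition lattice_basis p m (K : 'cV[int]_p -> Prop) (B : 'M[int]_(p, m)) :
    Prop :=
  [/\ forall j, K (col j B),
      forall x : 'cV[int]_m, B *m x = 0 -> x = 0
    & forall z, K z -> exists x : 'cV[int]_m, z = B *m x].

(* [z]_B; the default 0 is used only when z is not in the span of B. *)
Definition coord_col p m (B : 'M[int]_(p, m)) (z : 'cV[int]_p) : 'cV[int]_m :=
  classical_sets.xget 0 (fun x : 'cV[int]_m => z = B *m x).

Definition coord_mx p m n (B : 'M[int]_(p, m)) (D : 'M[int]_(p, n)) :
    'M[int]_(m, n) :=
  \matrix_(i < m, j < n) coord_col B (col j D) i 0.

Definition dotv p (x y : 'cV[int]_p) : int := \sum_(i < p) x i 0 * y i 0.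

End IntegerLattices.

(* Loops and multiple edges are allowed; (tail e, head e) is the fixed
   orientation of the edge e. *)
Record multigraph (V E : finType) := Multigraph { tail : E -> V; head : E -> V }.

Section Graphs.
Variables (V E : finType) (G : multigraph V E).

(* A spanning subgraph is identified with its edge set. *)
Definition adj (Y : {set E}) : rel V := fun u v =>
  [exists e in Y, ((tail G e == u) && (head G e == v)) ||
                  ((tail G e == v) && (head G e == u))].

Definition spanning_connected (Y : {set E}) : bool :=
  [forall u, forall v, connect (adj Y) u v].

(* The null graph is not connected. *)
Definition connected_graph : bool := (0 < #|V|)%N && spanning_connected setT.

(* A dart (e, true) traverses e along its orientation, (e, false) against it. *)
Definition dsrc (d : E * bool) : V := if d.2 then tail G d.1 else head G d.1.
Definition dtgt (d : E * bool) : V := if d.2 then head G d.1 else tail G d.1.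

(* A cycle traversed in one of its two directions: a nonempty closed walk
   without repeated vertices.  Edge-distinctness only excludes going back and
   forth along a single edge; loops (length 1) and pairs of parallel edges
   (length 2) are cycles. *)
Definition oriented_cycle (p : seq (E * bool)) : bool :=
  [&& p != [::], cycle (fun d d' => dtgt d == dsrc d') p,
      uniq [seq dsrc d | d <- p] & uniq [seq d.1 | d <- p]].

Definition edges_of (p : seq (E * bool)) : {set E} :=
  [set e in [seq d.1 | d <- p]].

(* The edges of an oriented cycle are distinct, so its length is #|C|. *)
Definition is_cycle (C : {set E}) : bool :=
  [exists p : #|C|.-tuple (E * bool), oriented_cycle p && (edges_of p == C)].

Definition cycle_vec (p : seq (E * bool)) : 'cV[int]_#|E| :=
  \col_i \sum_(d <- p | d.1 == enum_val i) (if d.2 then 1 else -1).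

Definition cycles_in (Y : {set E}) : {set {set E}} :=
  [set C : {set E} | is_cycle C & C \subset Y].

Definition spanning_trees : {set {set E}} :=
  [set T : {set E} | spanning_connected T & cycles_in T == set0].

Definition cycletrees : {set {set E}} :=
  [set Y : {set E} | spanning_connected Y & #|cycles_in Y| == 1%N].

(* z is the signed vector, for one of the two orientations, of a cycle of Y;
   if Y is a cycletree this cycle is C_Y. *)
Definition is_cycle_vec (Y : {set E}) (z : 'cV[int]_#|E|) : Prop :=
  exists p : seq (E * bool),
    [/\ oriented_cycle p, edges_of p \subset Y & z = cycle_vec p].

(* Column e is head e - tail e, hence zero for a loop. *)
Definition incidence_mx : 'M[int]_(#|V|, #|E|) :=
  \matrix_(i, j) ((head G (enum_val j) == enum_val i)%:R
                  - (tail G (enum_val j) == enum_val i)%:R).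

Definition unicyclizer n (D : 'M[int]_(#|E|, n)) : Prop :=
  [/\ forall x : 'cV[int]_n, D *m x = 0 -> x = 0,
      incidence_mx *m D = 0
    & quot_rank (mxker incidence_mx) (mxim D) 1].

Definition cycle_basis m (B : 'M[int]_(#|E|, m)) : Prop :=
  lattice_basis (mxker incidence_mx) B.

(* Every basis of Z_1(G) has m = #|E| - #|V| + 1 elements and every unicyclizer
   has m - 1 columns, so with n = m - 1 the types below cover all cases. *)
Definition winding n (B : 'M[int]_(#|E|, n.+1)) (D : 'M[int]_(#|E|, n))
    (z : 'cV[int]_#|E|) : int :=
  \det (row_mx (coord_col B z) (coord_mx B D) : 'M[int]_n.+1).

(* zY Y is the chosen cycle vector z_Y. *)
Definition lambda_vec n (B : 'M[int]_(#|E|, n.+1)) (D : 'M[int]_(#|E|, n))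
    (zY : {set E} -> 'cV[int]_#|E|) : 'cV[int]_#|E| :=
  \sum_(Y in cycletrees) winding B D (zY Y) *: zY Y.

End Graphs.

(* Main.v *)
(* For a spanning tree T and e outside T, the cycletree T + e has a unique cycle,
   and it passes through e; these cycles expand any C in Z_1(G) as
     C = sum_(e notin T) C_e z_(T+e)(e) z_(T+e).
   Apply the linear map w and sum over all T: the left side is k(G) w(C).  The
   pairs (T, e) are in bijection with the pairs (Y, e) with Y = T + e a cycletree
   and e on C_Y, so the right side is sum_Y w(z_Y) (C o z_Y).
   The graph-theoretic facts are obtained by pairing chains with potentials
   phi : V -> int; the only cycle construction needed is that the support of a
   nonzero element of Z_1(G) contains a cycle. *)
Require Import Defs.
From HB Require Import structures.
From mathcomp Require Import all_boot all_order all_algebra.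
From mathcomp Require classical_sets.
From mathcomp Require Import zify ring.

Set Implicit Arguments.
Unset Strict Implicit.
Unset Printing Implicit Defensive.

Import Order.TTheory GRing.Theory Num.Theory.
Local Open Scope ring_scope.

(** * Coordinates in a lattice basis and linearity of the winding number *)

Lemma coord_colK p m (K : 'cV[int]_p -> Prop) (B : 'M[int]_(p, m))
    (z : 'cV[int]_p) :
  lattice_basis K B -> K z -> B *m coord_col B z = z.
Proof.
move=> [_ _ spanB] /spanB[x ->]; rewrite /coord_col.
by case: classical_sets.xgetP => [y _ <- //|/(_ x)].
Qed.

Lemma coord_col_mul p m (K : 'cV[int]_p -> Prop) (B : 'M[int]_(p, m))
    (x : 'cV[int]_m) :
  lattice_basis K B -> coord_col B (B *m x) = x.
Proof.
move=> [_ injB _]; rewrite /coord_col.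
case: classical_sets.xgetP => [y _ eq_xy|/(_ x)//].
by apply/esym/eqP; rewrite -subr_eq0; apply/eqP/injB; rewrite mulmxBr -eq_xy subrr.
Qed.

(** Laplace expansion along the first column: its cofactors depend on [M] only, so they are computed
    with 0 in place of [x]. *)
Lemma det_row_mx_linear n (M : 'M[int]_(n.+1, n)) :
  exists k : 'I_n.+1 -> int, forall x : 'cV[int]_n.+1,
    \det (row_mx x M : 'M[int]_n.+1) = \sum_i x i 0 * k i.
Proof.
exists (fun i => cofactor (row_mx (0 : 'cV_n.+1) M : 'M[int]_n.+1) i ord0) => x.
rewrite (expand_det_col _ ord0); apply: eq_bigr => i _.
congr (_ * _).
  have -> : ord0 = lshift n (ord0 : 'I_1) by apply: val_inj.
  by rewrite (@row_mxEl _ n.+1 1 n).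
rewrite /cofactor; congr (_ * \det _); apply/matrixP=> a b; rewrite !mxE.
have -> : lift ord0 b = rshift 1 b by apply: val_inj.
by rewrite (unsplitK (inr b)).
Qed.

(** [coord_col] is meaningful only on the span of [B], whence the assumption on the [z i]; there
    coordinates are unique, hence linear. *)
Lemma winding_sum (V E : finType) (G : multigraph V E) n
    (D : 'M[int]_(#|E|, n)) (B : 'M[int]_(#|E|, n.+1)) (I : finType)
    (P : pred I) (a : I -> int) (z : I -> 'cV[int]_#|E|) :
  cycle_basis G B -> (forall i, P i -> mxker (incidence_mx G) (z i)) ->
  winding B D (\sum_(i | P i) a i *: z i) = \sum_(i | P i) a i * winding B D (z i).
Proof.
move=> hB kerz; rewrite /winding; have [k detE] := det_row_mx_linear (coord_mx B D).
have -> : \sum_(i | P i) a i *: z i =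
          B *m (\sum_(i | P i) a i *: coord_col B (z i)).
  rewrite mulmx_sumr; apply: eq_bigr => i Pi.
  by rewrite -scalemxAr (coord_colK hB) //; apply: kerz.
rewrite (coord_col_mul _ hB) detE.
under eq_bigr do rewrite summxE mulr_suml.
rewrite exchange_big; apply: eq_bigr => i Pi; rewrite detE mulr_sumr.
by apply: eq_bigr => j _; rewrite !mxE mulrA.
Qed.

(** * Chains paired with potentials *)

Section CycleSpace.
Variables (V E : finType) (G : multigraph V E).
(* Otherwise [head] would be [seq.head]. *)
Local Notation head := Defs.head.
Local Notation Z1 := (mxker (incidence_mx G)).
Local Notation coef z e := (z (enum_rank e) 0).
Implicit Types (z : 'cV[int]_#|E|) (e : E) (p : seq (E * bool)) (T Y : {set E}).

Lemma chain_eqP z z' : (forall e, coef z e = coef z' e) -> z = z'.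
Proof.
by move=> eqz; apply/colP=> i; have := eqz (enum_val i); rewrite enum_valK.
Qed.

(** Inner product of [z] with the coboundary of [phi], indexed by edges rather than by ordinals. *)
Definition pairing z (phi : V -> int) : int :=
  \sum_e coef z e * (phi (head G e) - phi (tail G e)).

(** Summation by parts: the coboundary is the transpose of the incidence matrix. *)
Lemma pairing_incidence z phi :
  pairing z phi = \sum_i phi (enum_val i) * (incidence_mx G *m z) i 0.
Proof.
transitivity (\sum_(v : V) \sum_(e : E)
    phi v * (((head G e == v)%:R - (tail G e == v)%:R) * coef z e)).
  have delta w : \sum_v phi v * (w == v)%:R = phi w.
    rewrite (bigD1 w) //= eqxx mulr1 big1 ?addr0 // => v /negPf.
    by rewrite eq_sym => ->; rewrite mulr0.
  rewrite exchange_big; apply: eq_bigr => e _ /=.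
  rewrite (eq_bigr (fun v => coef z e * (phi v * (head G e == v)%:R)
     - coef z e * (phi v * (tail G e == v)%:R))); last by move=> v _; ring.
  rewrite sumrB -!mulr_sumr mulrBr.
  by rewrite !delta.
rewrite (reindex (@enum_val V V)) /=; last exact/onW_bij/enum_val_bij.
apply: eq_bigr => i _; rewrite mxE mulr_sumr.
rewrite (reindex (@enum_val E E)) /=; last exact/onW_bij/enum_val_bij.
by apply: eq_bigr => j _; rewrite mxE enum_valK.
Qed.

Lemma Z1P z : Z1 z <-> forall phi, pairing z phi = 0.
Proof.
split=> [z0 phi|z0].
  by rewrite pairing_incidence z0 big1 // => i _; rewrite mxE mulr0.
(* The indicator of one vertex reads off the boundary coefficient there. *)
apply/colP=> i; have := z0 (fun v => (enum_rank v == i)%:R).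
rewrite pairing_incidence (bigD1 i) //= enum_valK eqxx mul1r big1 ?addr0 => [->|j].
  by rewrite mxE.
by rewrite enum_valK => /negPf->; rewrite mul0r.
Qed.

Lemma pairingD z z' phi : pairing (z + z') phi = pairing z phi + pairing z' phi.
Proof. by rewrite -big_split; apply: eq_bigr => e _; rewrite mxE mulrDl. Qed.

Lemma pairingZ a z phi : pairing (a *: z) phi = a * pairing z phi.
Proof. by rewrite mulr_sumr; apply: eq_bigr => e _; rewrite mxE mulrA. Qed.

Lemma Z1_sum (I : finType) (P : pred I) (a : I -> int) (z : I -> 'cV[int]_#|E|) :
  (forall i, P i -> Z1 (z i)) -> Z1 (\sum_(i | P i) a i *: z i).
Proof.
move=> kerz; rewrite /mxker mulmx_sumr big1 // => i /kerz kz.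
by rewrite -scalemxAr kz scaler0.
Qed.

Lemma Z1B z z' : Z1 z -> Z1 z' -> Z1 (z - z').
Proof. by rewrite /mxker mulmxBr => -> ->; rewrite subrr. Qed.

Lemma coef_delta e f : coef (delta_mx (enum_rank e) 0 : 'cV[int]_#|E|) f = (f == e)%:R.
Proof. by rewrite mxE eqxx andbT (inj_eq enum_rank_inj). Qed.

Lemma pairing_delta e phi :
  pairing (delta_mx (enum_rank e) 0) phi = phi (head G e) - phi (tail G e).
Proof.
rewrite /pairing (bigD1 e) //= coef_delta eqxx mul1r big1 ?addr0 // => f /negPf fe.
by rewrite coef_delta fe mul0r.
Qed.

(** * Vectors of oriented cycles *)

Definition dsign (d : E * bool) : int := if d.2 then 1 else -1.

Lemma coef_cycle_vec p e :
  coef (cycle_vec p) e = \sum_(d <- p | d.1 == e) dsign d.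
Proof. by rewrite mxE enum_rankK. Qed.

Lemma coef_cycle_vec_notin p e : e \notin edges_of p -> coef (cycle_vec p) e = 0.
Proof.
rewrite inE => ep; rewrite coef_cycle_vec big1_seq // => d /andP[/eqP de dp].
by case/negP: ep; rewrite -de map_f.
Qed.

(** Edges do not repeat along [p], so a single dart lies on [e] and the coefficient is its sign. *)
Lemma coef_cycle_vec_sqr p e : uniq [seq d.1 | d <- p] -> e \in edges_of p ->
  coef (cycle_vec p) e * coef (cycle_vec p) e = 1.
Proof.
rewrite inE coef_cycle_vec => up /mapP[d dp ->].
have -> : \sum_(d' <- p | d'.1 == d.1) dsign d' = dsign d.
  rewrite big_mkcond (bigD1_seq d) ?(map_uniq up) //= eqxx big1_seq ?addr0 //.
  move=> d' /andP[nd dp']; case: eqP => // ed.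
  case/eqP: nd; move: up dp dp' ed; elim: p => //= a p IHp /andP[ap up].
  rewrite !inE => /orP[/eqP->|dp] /orP[/eqP->|dp'] //; last exact: IHp.
    by move=> e'; rewrite -e' map_f in ap.
  by move=> e'; rewrite e' map_f in ap.
by rewrite /dsign; case: d.2; rewrite ?mulr1 ?mulrNN ?mulr1.
Qed.

Lemma coef_cycle_vec_neq0 p e : uniq [seq d.1 | d <- p] ->
  (coef (cycle_vec p) e != 0) = (e \in edges_of p).
Proof.
move=> up; have [ep|ep] := boolP (e \in _); last by rewrite coef_cycle_vec_notin ?eqxx.
by apply/eqP=> z0; have := coef_cycle_vec_sqr up ep; rewrite z0 mul0r.
Qed.

Lemma cycle_vec_Z1 p : cycle (fun d d' => dtgt G d == dsrc G d') p -> Z1 (cycle_vec p).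
Proof.
move=> cp; apply/Z1P=> phi.
have -> : pairing (cycle_vec p) phi = \sum_(d <- p) (phi (dtgt G d) - phi (dsrc G d)).
  rewrite /pairing; under eq_bigr do rewrite coef_cycle_vec mulr_suml.
  rewrite (exchange_big_dep xpredT) //=; apply: eq_bigr => d _.
  rewrite (big_pred1 d.1) => [|e]; last by rewrite /= eq_sym.
  by rewrite /dsign /dtgt /dsrc; case: d.2; ring.
rewrite sumrB; apply/eqP; rewrite subr_eq0; apply/eqP.
case: p cp => [|d0 p] /=; first by rewrite !big_nil.
(* The cycle unfolds to a path from [d0] back to [d0]; the induction frees the starting dart and
   keeps the end. *)
suff: forall d, path (fun d d' => dtgt G d == dsrc G d') d (rcons p d0) ->
   \sum_(d' <- d :: p) phi (dtgt G d') = \sum_(d' <- p) phi (dsrc G d') + phi (dsrc G d0).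
  by move=> H cp; rewrite (H _ cp) [RHS]big_cons addrC.
elim: p => [|d1 p IHp] d /=; first by rewrite andbT big_seq1 big_nil add0r => /eqP->.
by case/andP=> /eqP dd1 /IHp; rewrite big_cons => ->; rewrite [in RHS]big_cons dd1 addrA.
Qed.

(** * Cycles as edge sets, and cycles inside supports *)

Lemma is_cycle_edges_of p : oriented_cycle G p -> is_cycle G (edges_of p).
Proof.
move=> op; have /and4P[_ _ _ up] := op.
have sz : size p == #|edges_of p| by rewrite cardsE (card_uniqP up) size_map.
by apply/existsP; exists (Tuple sz); rewrite /= op eqxx.
Qed.

Lemma is_cycleP (A : {set E}) :
  reflect (exists2 p, oriented_cycle G p & edges_of p = A) (is_cycle G A).
Proof.
apply: (iffP existsP) => [[p /andP[op /eqP eA]]|[p op <-]]; first by exists p.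
exact/existsP/is_cycle_edges_of.
Qed.

Lemma exists_periodic (T : finType) (f : T -> T) x :
  exists k, fcycle f (orbit f (iter k f x)).
Proof.
have /trajectP[k lt_k eq_k] := looping_order f x.
(* The iterate of index [order f x] equals the earlier one of index [k], so their difference is a
   positive period; the criterion wants it as a successor. *)
exists k; apply/(orbitPcycle 3 0)%N; exists (order f x - k).-1.
by rewrite prednK ?subn_gt0 // -iterD subnK // ltnW.
Qed.

(* Orient each edge of the support so that its coefficient is positive: by
   conservation every vertex entered by such a dart is also left by one, so
   following darts closes up into a cycle. *)
Lemma support_has_cycle z e : Z1 z -> coef z e != 0 ->
  exists2 p, oriented_cycle G p & forall f, f \in edges_of p -> coef z f != 0.
Proof.
move=> /Z1P z0 ze.
pose P (d : E * bool) := 0 < dsign d * coef z d.1.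
have P_neq0 d : P d -> coef z d.1 != 0.
  by rewrite /P => Pd; apply/eqP => c0; rewrite c0 mulr0 ltxx in Pd.
have P_inj d d' : P d -> P d' -> d.1 = d'.1 -> d = d'.
  case: d d' => [f b] [f' b']; rewrite /P /dsign /= => Pd + ff'; rewrite -ff'.
  by move: (coef z f) Pd => c; case: b b' => -[] //; lia.
have P_next d : P d -> exists d', P d' && (dsrc G d' == dtgt G d).
  move=> Pd; apply/existsP; rewrite -[[exists _, _]]negbK; apply/negP => /existsPn noP.
  (* If no positive dart leaves this vertex, every edge contributes a nonnegative amount to the
     pairing with its indicator, and the edge of [d] a positive one: [noP d] prevents a loop. *)
  have := z0 (fun v => (v == dtgt G d)%:R); apply/eqP.
  rewrite /pairing (bigD1 d.1) //= gt_eqF // ltr_pwDl //.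
    move: Pd (noP d); rewrite /P => Pd; rewrite Pd /= => nd.
    move: Pd nd; rewrite /dsign /dsrc /dtgt; case: d.2 => Pd /negPf ->;
      by rewrite eqxx; move: (coef z _) Pd => c; lia.
  apply: sumr_ge0 => f _; move: (noP (f, true)) (noP (f, false)).
  rewrite /P /dsign /dsrc /= !negb_and.
  set x := (head G f == _); set y := (tail G f == _); case: x; case: y; lia.
have [d0 Pd0] : exists d0, P d0.
  by exists (e, 0 < coef z e); rewrite /P /dsign /=; move: (coef z e) ze => c;
     case: ifP; lia.
(* The default [d0] is never reached along the walk: each of its vertices is the target of a
   positive dart, so [P_next] applies. *)
pose out v := odflt d0 [pick d | P d && (dsrc G d == v)].
pose f v := dtgt G (out v).
have outP v : (exists d, P d && (dsrc G d == v)) -> P (out v) /\ dsrc G (out v) = v.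
  by rewrite /out; case: pickP => [d /andP[Pd /eqP sd] _ //|no [d]]; rewrite no.
pose x := dtgt G d0.
have outI k : P (out (iter k f x)) /\ dsrc G (out (iter k f x)) = iter k f x.
  elim: k => [|k [IHk _]]; first exact/outP/P_next.
  exact/outP/P_next.
have [k0 cyc] := exists_periodic f x; set y := iter k0 f x in cyc.
have outO v : v \in orbit f y -> P (out v) /\ dsrc G (out v) = v.
  by rewrite -fconnect_orbit => /iter_findex <-; rewrite -iterD.
exists [seq out v | v <- orbit f y]; last first.
  move=> g; rewrite inE -map_comp => /mapP[v /outO[Pv _] ->]; exact: P_neq0.
have srcE : [seq dsrc G d | d <- [seq out v | v <- orbit f y]] = orbit f y.
  by rewrite -map_comp -[RHS]map_id; apply/eq_in_map => v /outO[].
apply/and4P; split.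
- by rewrite -size_eq0 size_map size_orbit -lt0n order_gt0.
- rewrite cycle_map; apply: (sub_in_cycle (P := mem (orbit f y))) cyc; last exact/allP.
  by move=> a b _ /outO[_ /= ->].
- by rewrite srcE orbit_uniq.
(* An edge carries at most one positive dart, so distinct sources give distinct edges. *)
- rewrite -map_comp map_inj_in_uniq ?orbit_uniq // => a b /outO[Pa sa] /outO[Pb sb] /=.
  by move=> /(P_inj _ _ Pa Pb) eab; rewrite -sa -sb eab.
Qed.

(** Otherwise the support of [z] would contain a cycle, lying in [T]. Applied to differences, this
    determines an element of [Z1] by its coefficients outside [T]. *)
Lemma acyclic_Z1_eq0 T z : cycles_in G T = set0 -> Z1 z ->
  (forall e, e \notin T -> coef z e = 0) -> z = 0.
Proof.
move=> acT kz zT; apply: chain_eqP => e; rewrite [RHS]mxE.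
apply/eqP/negPn/negP=> /(support_has_cycle kz)[p op sp].
suff: edges_of p \in cycles_in G T by rewrite acT inE.
rewrite inE is_cycle_edges_of //; apply/subsetP => f /sp.
by apply: contraNT => /zT->.
Qed.

(** * Connectivity, walks and their chains *)

Lemma adj_sym Y : symmetric (adj G Y).
Proof.
move=> u v; rewrite /adj; apply: eq_existsb => e.
by congr (_ && _); rewrite orbC.
Qed.

Lemma connect_adj_sym Y : connect_sym (adj G Y).
Proof. exact/sym_connect_sym/adj_sym. Qed.

Lemma adj_edge Y e : e \in Y -> adj G Y (tail G e) (head G e).
Proof. by move=> eY; apply/existsP; exists e; rewrite eY !eqxx. Qed.

(** [z] is the signed sum of the edges of a walk; the pairing telescopes. *)
Lemma connect_chain T u v : connect (adj G T) u v ->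
  exists2 z : 'cV[int]_#|E|, forall e, e \notin T -> coef z e = 0 &
             forall phi, pairing z phi = phi v - phi u.
Proof.
case/connectP=> q + ->; elim: q u => [|w q IHq] u /=.
  exists 0 => [e _|phi]; first by rewrite mxE.
  by rewrite subrr /pairing big1 // => e _; rewrite mxE mul0r.
case/andP=> /existsP[e /andP[eT uw]] /IHq[z zT zphi].
have [s sphi] : exists s : int, forall phi,
    s * (phi (head G e) - phi (tail G e)) = phi w - phi u :> int.
  case/orP: uw => /andP[/eqP<- /eqP<-]; first by exists 1 => phi; ring.
  by exists (-1) => phi; ring.
exists (z + s *: delta_mx (enum_rank e) 0) => [f fT|phi].
  have fe : f != e by apply: contraNneq fT => ->.
  by rewrite mxE zT // mxE coef_delta (negPf fe) mulr0.
by rewrite pairingD zphi pairingZ pairing_delta sphi; ring.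
Qed.

(* The indicator of the component of tail e in Y \ e pairs with z to zero, and
   e is the only edge that could contribute. *)
Lemma spanning_connectedD1 Y z e : spanning_connected G Y -> Z1 z ->
  (forall f, f \notin Y -> coef z f = 0) -> coef z e != 0 ->
  spanning_connected G (Y :\ e).
Proof.
move=> conY /Z1P z0 zY ze.
have conn_e : connect (adj G (Y :\ e)) (tail G e) (head G e).
  pose c v := connect (adj G (Y :\ e)) (tail G e) v.
  have := z0 (fun v => (c v)%:R); rewrite /pairing (bigD1 e) //= big1.
    have -> : c (tail G e) by exact: connect0.
    rewrite addr0 /c; case: connect => // /eqP.
    by rewrite mulf_eq0 (negPf ze).
  move=> f fe; have [fY|/zY->] := boolP (f \in Y); last by rewrite mul0r.
  suff -> : c (head G f) = c (tail G f) by rewrite subrr mulr0.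
  have cf : connect (adj G (Y :\ e)) (tail G f) (head G f).
    by apply/connect1/adj_edge; rewrite !inE fe.
  by rewrite /c -(same_connect_r (@connect_adj_sym _) cf).
apply/forallP => u; apply/forallP => v; have /forallP/(_ u)/forallP/(_ v) := conY.
apply: connect_sub => {u v} u v /existsP[f /andP[fY uv]].
have cf : connect (adj G (Y :\ e)) (tail G f) (head G f).
  have [-> //|fe] := eqVneq f e.
  by apply/connect1/adj_edge; rewrite !inE fe.
by case/orP: uv => /andP[/eqP<- /eqP<-] //; rewrite connect_adj_sym.
Qed.

Lemma spanning_connectedS T Y : T \subset Y ->
  spanning_connected G T -> spanning_connected G Y.
Proof.
move=> sTY conT; apply/forallP => u; apply/forallP => v.
have /forallP/(_ u)/forallP/(_ v) := conT; apply: connect_sub => {u v} u v.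
case/existsP=> f /andP[fT uv]; apply/connect1/existsP; exists f.
by rewrite uv (subsetP sTY).
Qed.

(** * Spanning trees and cycletrees *)

Lemma spanning_treeP T :
  reflect (spanning_connected G T /\ cycles_in G T = set0) (T \in spanning_trees G).
Proof. by rewrite inE; apply: (iffP andP) => -[-> /eqP]. Qed.

Lemma cycle_of_treeU1 T e p : cycles_in G T = set0 ->
  oriented_cycle G p -> edges_of p \subset e |: T -> e \in edges_of p.
Proof.
move=> acT op sp; apply: contraT => ep.
suff: edges_of p \in cycles_in G T by rewrite acT inE.
rewrite inE is_cycle_edges_of //; apply/subsetP => f fp.
have := subsetP sp _ fp; rewrite !inE => /orP[/eqP fe|//].
by rewrite fe (negPf ep) in fp.
Qed.

(** Closing a walk of [T] from the head of [e] to its tail by [e] gives an element of [Z1] nonzero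
    at [e], whose support contains a cycle. *)
Lemma treeU1_cycletree T e : T \in spanning_trees G -> e \notin T ->
  e |: T \in cycletrees G.
Proof.
case/spanning_treeP=> conT acT eT; rewrite inE.
rewrite (spanning_connectedS (subsetUr _ _) conT) /=.
have [z zT zphi] : exists2 z : 'cV[int]_#|E|, forall f, f \notin T -> coef z f = 0 &
    forall phi, pairing z phi = phi (tail G e) - phi (head G e).
  exact/connect_chain/(forallP (forallP conT _)).
pose y := z + delta_mx (enum_rank e) 0.
have ky : Z1 y by apply/Z1P => phi; rewrite pairingD zphi pairing_delta; ring.
have ye : coef y e != 0 by rewrite mxE zT // coef_delta eqxx.
have [p op sp] := support_has_cycle ky ye.
have pT : edges_of p \subset e |: T.
  apply/subsetP => f /sp; apply: contraNT; rewrite !inE negb_or => /andP[/negPf fe fT].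
  by rewrite mxE zT // coef_delta fe.
apply/cards1P; exists (edges_of p); apply/setP => A; rewrite !inE.
apply/andP/eqP => [[/is_cycleP[q oq <-] qT]|->]; last by rewrite is_cycle_edges_of.
have ep := cycle_of_treeU1 acT op pT; have eq := cycle_of_treeU1 acT oq qT.
have /and4P[_ cp _ up] := op; have /and4P[_ cq _ uq] := oq.
have Zp := cycle_vec_Z1 cp; have Zq := cycle_vec_Z1 cq.
pose a := coef (cycle_vec p) e; pose b := coef (cycle_vec q) e.
have a0 : a != 0 by rewrite coef_cycle_vec_neq0.
have b0 : b != 0 by rewrite coef_cycle_vec_neq0.
(* Two cycles of [e |: T] both use [e]. This combination cancels there, so it vanishes outside [T];
   proportional vectors then have equal supports. *)
have eq0 : b *: cycle_vec p - a *: cycle_vec q = 0.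
  apply: (acyclic_Z1_eq0 acT).
    by apply: Z1B; rewrite /mxker -scalemxAr ?Zp ?Zq scaler0.
  move=> f fT; rewrite mxE [X in _ + X]mxE.
  rewrite [X in X - _]mxE [X in _ - X]mxE.
  have [->|fe] := eqVneq f e; first by rewrite -/a -/b; ring.
  by rewrite !coef_cycle_vec_notin ?mulr0 ?subr0 //;
    [move/subsetP/(_ f): qT | move/subsetP/(_ f): pT] => /contra; apply;
    rewrite !inE negb_or fe.
apply/setP => f; rewrite -!coef_cycle_vec_neq0 //.
move/eqP: eq0; rewrite subr_eq0 => /eqP/matrixP/(_ (enum_rank f) 0).
rewrite [LHS]mxE [RHS]mxE => eq0; apply: negb_inj; rewrite !negbK.
have := congr1 (fun t => t == 0) eq0; rewrite !mulf_eq0 (negPf a0) (negPf b0) /=.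
by move=> ->.
Qed.

Lemma cycletree_cycles Y p : Y \in cycletrees G -> oriented_cycle G p ->
  edges_of p \subset Y -> cycles_in G Y = [set edges_of p].
Proof.
rewrite inE => /andP[_ /cards1P[A YA]] op sp; rewrite YA.
suff: edges_of p \in cycles_in G Y by rewrite YA inE => /eqP->.
by rewrite inE is_cycle_edges_of.
Qed.

(** Deleting an edge of the cycle preserves connectivity and destroys the only cycle; conversely, if
    the deletion leaves no cycle, then [p] used [e]. *)
Lemma cycletreeD1 Y p e : Y \in cycletrees G -> oriented_cycle G p ->
  edges_of p \subset Y -> (e \in edges_of p) = (e \in Y) && (Y :\ e \in spanning_trees G).
Proof.
move=> hY op sp; have cY := cycletree_cycles hY op sp.
have /and4P[_ cp _ up] := op; have Zp := cycle_vec_Z1 cp.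
apply/idP/andP=> [ep|[eY /spanning_treeP[_ acY]]]; last first.
  apply: (cycle_of_treeU1 acY op); apply: subset_trans sp _.
  by rewrite setD1K.
split; first exact: subsetP ep.
apply/spanning_treeP; split.
  apply: (spanning_connectedD1 _ Zp) => [|f fY|]; first by case/setIdP: hY.
    by apply: coef_cycle_vec_notin; apply: contra fY; apply: subsetP.
  by rewrite coef_cycle_vec_neq0.
apply/setP => A; rewrite [RHS]inE inE; apply/negP => /andP[cA sA].
have /setP/(_ A) := cY; rewrite !inE cA (subset_trans sA (subsetDl _ _)) /=.
by move/esym/eqP => eA; have := subsetP sA e; rewrite eA => /(_ ep); rewrite !inE eqxx.
Qed.

(** Both sides agree at each edge [f] outside [T]: only the cycle of [f |: T] contributes, and its
    coefficient at [f] squares to 1. *)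
Lemma fundamental_cycle_expansion T (zY : {set E} -> 'cV[int]_#|E|)
    (C : 'cV[int]_#|E|) :
  (forall Y, Y \in cycletrees G -> is_cycle_vec G Y (zY Y)) ->
  T \in spanning_trees G -> Z1 C ->
  C = \sum_(e | e \notin T)
        (coef C e * coef (zY (e |: T)) e) *: zY (e |: T).
Proof.
move=> hzY hT kC; have [conT acT] := spanning_treeP _ hT.
apply/eqP; rewrite -subr_eq0; apply/eqP.
apply: (acyclic_Z1_eq0 acT) => [|f fT].
  apply: Z1B => //; apply: Z1_sum => e eT.
  have [p [/and4P[_ cp _ _] _ ->]] := hzY _ (treeU1_cycletree hT eT).
  exact: cycle_vec_Z1.
rewrite mxE [X in _ + X]mxE summxE (bigD1 f) //= big1 ?addr0 => [|e /andP[eT ef]].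
  rewrite mxE; have [p [op sp ->]] := hzY _ (treeU1_cycletree hT fT).
  have /and4P[_ _ _ up] := op.
  rewrite -mulrA coef_cycle_vec_sqr ?mulr1 ?subrr //.
  exact: cycle_of_treeU1 op sp.
have [p [op sp ->]] := hzY _ (treeU1_cycletree hT eT).
rewrite mxE [X in _ * X]coef_cycle_vec_notin ?mulr0 //.
by apply: contra fT => /(subsetP sp); rewrite !inE eq_sym (negPf ef).
Qed.

End CycleSpace.

Theorem theorem5p1p1 (V E : finType) (G : multigraph V E)
    (hG : connected_graph G)
    (n : nat) (D : 'M[int]_(#|E|, n)) (hD : unicyclizer G D)
    (B : 'M[int]_(#|E|, n.+1)) (hB : cycle_basis G B)
    (zY : {set E} -> 'cV[int]_#|E|)
    (hzY : forall Y : {set E}, Y \in cycletrees G -> is_cycle_vec G Y (zY Y))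
    (C : 'cV[int]_#|E|) (hC : mxker (incidence_mx G) C) :
  dotv C (lambda_vec G B D zY) = winding B D C * #|spanning_trees G|%:Z.
Proof.
pose F Y e := C (enum_rank e) 0 * zY Y (enum_rank e) 0 * winding B D (zY Y).
transitivity (\sum_(Y in cycletrees G) \sum_e F Y e).
  rewrite /dotv /lambda_vec [RHS]exchange_big /=.
  rewrite (reindex (@enum_rank E)) /=; last exact/onW_bij/enum_rank_bij.
  apply: eq_bigr => e _.
  rewrite summxE mulr_sumr; apply: eq_bigr => Y _.
  by rewrite mxE /F; ring.
transitivity (\sum_(T in spanning_trees G) \sum_(e | e \notin T) F (e |: T) e).
  rewrite [LHS]exchange_big [RHS](exchange_big_dep xpredT) //=; apply: eq_bigr => e _.
  (* Pairs for which [Y :\ e] is not a spanning tree vanish, as [e] is then off the cycle of [Y]. *)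
  rewrite (bigID (fun Y : {set E} => (e \in Y) && (Y :\ e \in spanning_trees G))) /=.
  rewrite addrC big1 ?add0r => [|Y /andP[hY]]; last first.
    have [p [op sp zE]] := hzY _ hY; rewrite -(cycletreeD1 e hY op sp) => ep.
    by rewrite /F zE coef_cycle_vec_notin // mulr0 mul0r.
  (* For fixed [e], adding and removing [e] are inverse to each other; the round trip from [T]
     returns [T] exactly when [e] is outside [T]. *)
  rewrite (reindex_onto (fun T => e |: T) (fun Y => Y :\ e)) /=; last first.
    by move=> Y /andP[_ /andP[eY _]]; rewrite setD1K.
  apply: eq_bigl => T; rewrite setU11 /=.
  have [eT|eT] := boolP (e \in T).
    rewrite andbF; apply/negbTE; rewrite negb_and; apply/orP; right.
    by apply/eqP => /setP/(_ e); rewrite !inE eqxx eT.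
  rewrite setU1K // eqxx !andbT andb_idl // => hT.
  exact: treeU1_cycletree.
transitivity (\sum_(T in spanning_trees G) winding B D C); last first.
  by rewrite sumr_const -mulr_natr natz.
(* Tree by tree, linearity over the fundamental cycles turns [winding B D C] into the inner sum. *)
apply: eq_bigr => T hT; rewrite [in RHS](fundamental_cycle_expansion hzY hT hC).
rewrite (winding_sum _ _ hB) // => e eT.
have [p [/and4P[_ cp _ _] _ ->]] := hzY _ (treeU1_cycletree hT eT).
exact: cycle_vec_Z1.
Qed.
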